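(* Let $\Gamma^1=(G,\sigma_1,\mu_1)$ be a $\gamma_1$-regular signed graph on $n_1$ vertices and $m_1$ edges, let $\theta$ be any $r$-orientation of the edges of $\Gamma^1$, and let $\Gamma^2=(H,\sigma_2,\mu_2)$ be an arbitrary signed graph on $n_2$ vertices. Let $\lambda_1(L(\Gamma^1)),\dots,\lambda_{n_1}(L(\Gamma^1))$ be the eigenvalues of $L(\Gamma^1)$. If $\lambda$ is not a pole of $\Sigma_{L(\Gamma^2)}(\lambda-2)$, then $$f_{L((\Gamma^1\boxminus\Gamma^2)_\theta)}(\lambda)=(\lambda-2)^{m_1-n_1}\big(f_{L(\Gamma^2)}(\lambda-2)\big)^{m_1}\prod_{j=1}^{n_1}\Big(\lambda^2-(\gamma_1+2+\gamma_1n_2)\lambda+2\gamma_1(n_2+1)-\big(1+(\lambda-2)\Sigma_{L(\Gamma^2)}(\lambda-2)\big)\big(2\gamma_1-\lambda_j(L(\Gamma^1))\big)\Big).$$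
   Context: A signed graph $\Gamma=(G,\sigma,\mu)$ has a finite simple graph $G$ with vertices $v_1,\dots,v_n$, signature $\sigma:E(G)\to\{\pm1\}$ and marking $\mu:V(G)\to\{\pm1\}$; $\mu(\Gamma)=(\mu(v_1),\dots,\mu(v_n))^T$. $A(\Gamma)$ has $(i,j)$ entry $\sigma(v_iv_j)$ if $v_i\sim v_j$ and $0$ otherwise; $D(\Gamma)$ is the diagonal matrix of (unsigned) degrees; $L(\Gamma)=D(\Gamma)-A(\Gamma)$. $\gamma$-regular means all degrees equal $\gamma$. $f_M(\lambda)=\det(\lambda I-M)$. The signed $N$-coronal is the rational function $\Sigma_N(X)=\mu(\Gamma)^T(XI_n-N)^{-1}\mu(\Gamma)$. An $r$-orientation of $(G,\sigma)$ is a map $\theta:V(G)\times E(G)\to\{-1,0,1\}$ with $\theta(w,uv)=0$ for $w\notin\{u,v\}$, $\theta(u,uv)\in\{\pm1\}$ at endpoints, and $\theta(u,uv)\theta(v,uv)=\sigma(uv)$. The subdivision graph $S(\Gamma^1_\theta)$ is obtained by inserting a new vertex $v_e$ into each edge $e$ of $\Gamma^1$, the edge $v_iv_e$ having sign $\theta(v_i,e)$. With $E(\Gamma^1)=\{e_1,\dots,e_{m_1}\}$, the subdivision edge neighbourhood corona $(\Gamma^1\boxminus\Gamma^2)_\theta$ is obtained from $S(\Gamma^1_\theta)$ and $m_1$ disjoint copies of $\Gamma^2$ by joining, for each $t$, both endpoints $v$ of $e_t$ to every vertex $u$ of the $t$-th copy, with sign $\theta(v,e_t)\mu_2(u)$,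 where $\mu_2(u)$ is the marking of the corresponding vertex of $\Gamma^2$.
   Formalization: At λ = 2 the pointwise formula is stated only when n₁ ≤ m₁, since otherwise (λ−2)^{m₁−n₁} is undefined (e.g. Γ¹ = K₂); the formula is also proved as an identity of rational functions in λ, which covers that case. *)

(* Defs.v *)
From HB Require Import structures.
From mathcomp Require Import all_boot all_order all_algebra.

Set Implicit Arguments.
Unset Strict Implicit.
Unset Printing Implicit Defensive.

Import Order.TTheory GRing.Theory Num.Theory.
Local Open Scope ring_scope.

Definition is_sign (x : int) : bool := (x == 1) || (x == -1).

(* The pair (G, sigma).  The signature is given on pairs of endpoints; its     *)
(* values on non-adjacent pairs are irrelevant.                                *)
Record sigraph := Sigraph {
  vertex :> finType;
  adj : rel vertex;
  sgn : vertex -> vertex -> int;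
  adj_sym : symmetric adj;
  adj_irrefl : irreflexive adj;
  sgn_sym : forall u v, adj u v -> sgn u v = sgn v u;
  sgn_sign : forall u v, adj u v -> is_sign (sgn u v)
}.

Record signed_graph := SignedGraph {
  sg_base :> sigraph;
  mark : sg_base -> int;
  mark_sign : forall u, is_sign (mark u)
}.

Definition edge_set (G : sigraph) : {set {set G}} :=
  [set [set p.1; p.2] | p : G * G & adj p.1 p.2].

Definition edge (G : sigraph) : finType := {e : {set G} | e \in edge_set G}.

Definition degree (G : sigraph) (u : G) : nat := #|[set v | adj u v]|.

Definition regular (G : sigraph) (g : nat) : Prop :=
  forall u : G, degree u = g.

Section Matrices.
Variable R : nzRingType.

Definition adjmx (G : sigraph) : 'M[R]_#|G| :=
  \matrix_(i, j) if adj (enum_val i) (enum_val j)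
                 then (sgn (enum_val i) (enum_val j))%:~R else 0.

Definition degmx (G : sigraph) : 'M[R]_#|G| :=
  diag_mx (\row_i (degree (enum_val i))%:R).

Definition lapmx (G : sigraph) : 'M[R]_#|G| := degmx G - adjmx G.

Definition markv (G : signed_graph) : 'cV[R]_#|G| :=
  \col_i (mark (enum_val i))%:~R.

End Matrices.

Definition coronal (K : fieldType) (n : nat) (N : 'M[K]_n) (mu : 'cV[K]_n)
    (x : K) : K :=
  (mu^T *m invmx (x%:M - N) *m mu) 0 0.

(* To be used with K := {fraction {poly F}}, where x%:M - L is invertible for  *)
(* every non-constant x: the value at x = 'X is then the rational function     *)
(* Sigma_L(X), and the value at x = 'X - 2 is Sigma_L(X - 2).                  *)
Definition lap_coronal (K : fieldType) (G : signed_graph) (x : K) : K :=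
  coronal (lapmx K G) (markv K G) x.

Section RationalFunctions.
Variable F : fieldType.

Definition ratX : {fraction {poly F}} := tofrac 'X.

Definition ratC (c : F) : {fraction {poly F}} := tofrac c%:P.

(* Numerator and denominator in lowest terms (unique up to a nonzero constant) *)
Definition rat_num (f : {fraction {poly F}}) : {poly F} :=
  \n_(repr f) %/ gcdp \n_(repr f) \d_(repr f).

Definition rat_den (f : {fraction {poly F}}) : {poly F} :=
  \d_(repr f) %/ gcdp \n_(repr f) \d_(repr f).

Definition rat_pole (f : {fraction {poly F}}) (a : F) : bool :=
  root (rat_den f) a.

(* Meaningful only when a is not a pole of f *)
Definition rat_eval (f : {fraction {poly F}}) (a : F) : F :=
  (rat_num f).[a] / (rat_den f).[a].

End RationalFunctions.

Record r_orientation (G : sigraph) := ROrientation {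
  theta :> G -> edge G -> int;
  theta_out : forall w (e : edge G), w \notin val e -> theta w e = 0;
  theta_end : forall u (e : edge G), u \in val e -> is_sign (theta u e);
  theta_sgn : forall u v (e : edge G),
    val e = [set u; v] -> theta u e * theta v e = sgn u v
}.

Lemma is_signM (x y : int) : is_sign x -> is_sign y -> is_sign (x * y).
Proof. by case/orP=> /eqP-> /orP[] /eqP->. Qed.

Section Subdivision.
Variables (G : sigraph) (th : r_orientation G).

Definition subdiv_vertex : finType := (G + edge G)%type.

Definition subdiv_adj (x y : subdiv_vertex) : bool :=
  match x, y with
  | inl v, inr e | inr e, inl v => v \in val e
  | _, _ => false
  end.

Definition subdiv_sgn (x y : subdiv_vertex) : int :=
  match x, y with
  | inl v, inr e | inr e, inl v => th v e
  | _, _ => 0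
  end.

Lemma subdiv_adj_sym : symmetric subdiv_adj.
Proof. by move=> [u|e] [v|f]. Qed.

Lemma subdiv_adj_irrefl : irreflexive subdiv_adj.
Proof. by case. Qed.

Lemma subdiv_sgn_sym x y : subdiv_adj x y -> subdiv_sgn x y = subdiv_sgn y x.
Proof. by case: x y => [u|e] [v|f]. Qed.

Lemma subdiv_sgn_sign x y : subdiv_adj x y -> is_sign (subdiv_sgn x y).
Proof. by case: x y => [u|e] [v|f] //= /theta_end. Qed.

Definition subdivision : sigraph :=
  Sigraph subdiv_adj_sym subdiv_adj_irrefl subdiv_sgn_sym subdiv_sgn_sign.

End Subdivision.

Section Corona.
Variables (G : sigraph) (th : r_orientation G) (H : signed_graph).

(* inr (e, u) is the vertex u in the copy of H attached to the edge e of G.    *)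
Definition corona_vertex : finType := (subdivision th + edge G * H)%type.

Definition corona_adj (x y : corona_vertex) : bool :=
  match x, y with
  | inl a, inl b => adj a b
  | inl (inl v), inr (e, _) | inr (e, _), inl (inl v) => v \in val e
  | inr (e, u), inr (f, w) => (e == f) && adj u w
  | _, _ => false
  end.

Definition corona_sgn (x y : corona_vertex) : int :=
  match x, y with
  | inl a, inl b => sgn a b
  | inl (inl v), inr (e, u) | inr (e, u), inl (inl v) => th v e * mark u
  | inr (_, u), inr (_, w) => sgn u w
  | _, _ => 0
  end.

Lemma corona_adj_sym : symmetric corona_adj.
Proof. by move=> [[v|e]|[e u]] [[w|f]|[f w]] //=; rewrite eq_sym adj_sym. Qed.

Lemma corona_adj_irrefl : irreflexive corona_adj.
Proof. by move=> [[v|e]|[e u]] //=; rewrite adj_irrefl andbF. Qed.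

Lemma corona_sgn_sym x y : corona_adj x y -> corona_sgn x y = corona_sgn y x.
Proof.
by case: x y => [[v|e]|[e u]] [[w|f]|[f w]] //= /andP[_ /sgn_sym].
Qed.

Lemma corona_sgn_sign x y : corona_adj x y -> is_sign (corona_sgn x y).
Proof.
case: x y => [[v|e]|[e u]] [[w|f]|[f w]] //=; try exact: theta_end.
- by move=> ve; apply: is_signM (theta_end th ve) (mark_sign w).
- by move=> we; apply: is_signM (theta_end th we) (mark_sign u).
- by case/andP=> _ /sgn_sign.
Qed.

Definition corona : sigraph :=
  Sigraph corona_adj_sym corona_adj_irrefl corona_sgn_sym corona_sgn_sign.

End Corona.

(* lam lists the eigenvalues of M with algebraic multiplicity.                 *)
Definition eigenvalues_of (F : fieldType) (n : nat) (M : 'M[F]_n)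
    (lam : 'I_n -> F) : Prop :=
  char_poly M = \prod_(j < n) ('X - (lam j)%:P).

(* Main.v *)
Require Import Defs.
From HB Require Import structures.
From mathcomp Require Import all_boot all_order all_algebra.
From mathcomp Require Import perm ring.
Import Order.TTheory GRing.Theory Num.Theory.
Local Open Scope ring_scope.

Set Implicit Arguments.
Unset Strict Implicit.
Unset Printing Implicit Defensive.

(** Group every subdivision vertex with its copy of [H]: the matrix
    [x - L] of the corona becomes a 2 x 2 block matrix whose lower right block
    is block diagonal, with equal blocks [diag (x - 2, x - 2 - L H)], and whose
    off-diagonal blocks are [theta] tensored with the marking [(1, mu)].  Its Schur complement is
    [(x - g (n2 + 1)) - (1 / (x - 2) + Sigma (x - 2)) theta theta^T], where
    [theta theta^T = 2 g - L G] by regularity.  This works over the field of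
    rational functions at [x = X], where [X - 2] and [X - 2 - L H] are
    invertible; the pointwise formula is then the value of that identity. *)

(** * Determinants of matrices indexed by finite types *)

Section FinMatrix.
Variable K : fieldType.

(** Entries are given on elements of the index types, so that sums and block decompositions can be
    handled without ordinals. The Laplacians are indexed through [enum_val] in the same way. *)
Definition finmx (S T : finType) (f : S -> T -> K) : 'M[K]_(#|S|, #|T|) :=
  \matrix_(i, j) f (enum_val i) (enum_val j).

Lemma eq_finmx (S T : finType) (f g : S -> T -> K) :
  f =2 g -> finmx f = finmx g.
Proof. by move=> fg; apply/matrixP=> i j; rewrite !mxE fg. Qed.

Lemma sum_enum_val (T : finType) (F : T -> K) :
  \sum_(i < #|T|) F (enum_val i) = \sum_(x : T) F x.
Proof.
rewrite [RHS](reindex (@enum_val T predT)) //=.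
by apply: onW_bij; apply: enum_val_bij.
Qed.

Lemma mul_finmx (S T U : finType) (f : S -> T -> K) (g : T -> U -> K) :
  finmx f *m finmx g = finmx (fun x z => \sum_y f x y * g y z).
Proof.
apply/matrixP=> i j; rewrite !mxE -[RHS]sum_enum_val.
by apply: eq_bigr=> k _; rewrite !mxE.
Qed.

Lemma scalar_finmx (T : finType) (a : K) :
  a%:M = finmx (fun x y : T => a *+ (x == y)).
Proof. by apply/matrixP=> i j; rewrite !mxE (inj_eq enum_val_inj). Qed.

(** Two enumerations of [T] differ by a permutation [s], which acts on rows and columns at once, so
    its sign occurs twice and cancels. *)
Lemma det_reindex (n : nat) (T : finType) (h : 'I_n -> T) (f : T -> T -> K) :
  bijective h -> \det (\matrix_(i, j) f (h i) (h j)) = \det (finmx f).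
Proof.
move=> hbij; have /esym := bij_eq_card hbij; rewrite card_ord => en; subst n.
have inj0 : injective (fun i : 'I_#|T| => enum_rank (h i)).
  by move=> i j /enum_rank_inj /(bij_inj hbij).
pose s := perm inj0.
have -> : \matrix_(i, j) f (h i) (h j) = row_perm s (col_perm s (finmx f)).
  by apply/matrixP=> i j; rewrite !mxE !permE !enum_rankK.
rewrite row_permE col_permE !det_mulmx !det_perm mulrCA -signr_addb.
by rewrite odd_permV addbb mulr1.
Qed.

Lemma det_finmx_bij (S T : finType) (h : S -> T) (f : T -> T -> K) :
  bijective h -> \det (finmx f) = \det (finmx (fun x y => f (h x) (h y))).
Proof.
move=> hbij; rewrite -(@det_reindex _ _ (h \o @enum_val S predT)) //.
by apply: bij_comp hbij _; apply: enum_val_bij.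
Qed.

(** The enumeration of [S + T] is replaced by the one through [split], which lists [S] first and
    then [T]. *)
Lemma det_finmx_sum (S T : finType) (f : S + T -> S + T -> K) :
  \det (finmx f) =
  \det (block_mx (finmx (fun x y => f (inl x) (inl y)))
                 (finmx (fun x y => f (inl x) (inr y)))
                 (finmx (fun x y => f (inr x) (inl y)))
                 (finmx (fun x y => f (inr x) (inr y)))).
Proof.
pose h (i : 'I_(#|S| + #|T|)) : S + T :=
  match split i with inl j => inl (enum_val j) | inr j => inr (enum_val j) end.
pose g (x : S + T) : 'I_(#|S| + #|T|) :=
  match x with
  | inl s => lshift _ (enum_rank s)
  | inr t => rshift _ (enum_rank t)
  end.
have hbij : bijective h.
  exists g => [i | [x|x]]; rewrite /h /g /=.
  - by case: splitP => j ej; apply: val_inj; rewrite /= enum_valK ej.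
  - by rewrite (unsplitK (inl _)) enum_rankK.
  - by rewrite (unsplitK (inr _)) enum_rankK.
rewrite -(det_reindex _ hbij); congr (\det _); apply/matrixP=> i j.
by rewrite !mxE /h; case: (split i) => i'; rewrite mxE;
  case: (split j) => j'; rewrite !mxE.
Qed.

(** A unipotent upper triangular factor with corner [B *m D'] splits off and leaves a lower
    triangular one. The inverse is an argument [D'] so that an explicit formula can be supplied. *)
Lemma det_Schur (n m : nat) (A : 'M[K]_n) (B : 'M_(n, m)) (C : 'M_(m, n))
    (D D' : 'M_m) : D' *m D = 1%:M ->
  \det (block_mx A B C D) = \det D * \det (A - B *m D' *m C).
Proof.
move=> D'D.
have -> : block_mx A B C D =
  block_mx 1%:M (B *m D') 0 1%:M *m block_mx (A - B *m D' *m C) 0 C D.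
  rewrite mulmx_block !mul1mx !mul0mx !add0r subrK.
  by rewrite -mulmxA D'D mulmx1.
by rewrite det_mulmx det_ublock det_lblock !det1 !mul1r mulrC.
Qed.

(** Induction on [m]: splitting off the copy with index [ord0] gives a block triangular matrix,
    since entries between distinct copies vanish. *)
Lemma det_finmx_diag_ord (m : nat) (W : finType) (g : W -> W -> K) :
  \det (finmx (fun x y : 'I_m * W => g x.2 y.2 *+ (x.1 == y.1))) =
  \det (finmx g) ^+ m.
Proof.
elim: m => [|m IHm].
  (* The index type is empty for [m = 0], so this is the determinant of a 0 x 0 matrix. *)
  by rewrite expr0 -(det_mx00 (0 : 'M[K]_0)) -(@det_reindex 0 _
       (fun i => let: Ordinal _ p := i in match notF p with end)) ?det_mx00 //;
     exists (fun x => x.1) => [[]|[[]]].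
pose h (x : W + 'I_m * W) : 'I_m.+1 * W :=
  match x with inl w => (ord0, w) | inr (i, w) => (lift ord0 i, w) end.
pose k (x : 'I_m.+1 * W) : W + 'I_m * W :=
  if unlift ord0 x.1 is Some i then inr (i, x.2) else inl x.2.
have hbij : bijective h.
  exists k => [[w|[i w]]|[i w]]; rewrite /h /k /=.
  - by rewrite unlift_none.
  - by rewrite liftK.
  - by case: unliftP => [j ->|->].
rewrite (det_finmx_bij _ hbij) det_finmx_sum.
have -> : finmx (fun (x : W) (y : 'I_m * W) =>
   g (h (inl x)).2 (h (inr y)).2 *+ ((h (inl x)).1 == (h (inr y)).1)) = 0.
  by apply/matrixP=> i j; rewrite !mxE; case: (enum_val j).
rewrite det_lblock exprS; congr (_ * _); last rewrite -IHm; congr (\det _).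
by apply: eq_finmx => -[i w] [j v] /=; rewrite (inj_eq lift_inj).
Qed.

Lemma det_finmx_diag (E W : finType) (g : W -> W -> K) :
  \det (finmx (fun x y : E * W => g x.2 y.2 *+ (x.1 == y.1))) =
  \det (finmx g) ^+ #|E|.
Proof.
pose h (x : 'I_#|E| * W) : E * W := (enum_val x.1, x.2).
have hbij : bijective h.
  by exists (fun x => (enum_rank x.1, x.2)) => -[i w];
    rewrite /h /= ?enum_valK ?enum_rankK.
rewrite (det_finmx_bij _ hbij) -det_finmx_diag_ord; congr (\det _).
by apply: eq_finmx => x y; rewrite /= (inj_eq enum_val_inj).
Qed.


Lemma sum_pair_diag (E W : finType) (F : E -> W -> K) (e : E) :
  \sum_(y : E * W) F y.1 y.2 *+ (y.1 == e) = \sum_w F e w.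
Proof.
rewrite -(pair_bigA _ (fun e' w => F e' w *+ (e' == e))) (bigD1 e) //=.
rewrite [X in _ + X]big1 ?addr0.
  by apply: eq_bigr=> w _; rewrite eqxx.
by move=> e' /negPf->; rewrite big1.
Qed.

(** The lower right block has the block diagonal inverse with blocks [h]. In the Schur complement
    the correction at [(v, w)] is the sum over [e], [t], [u] of
    [r v e * nu t * h t u * nu u * r w e], and the sums over [t], [u] separate from the sum over
    [e]. *)
Lemma det_arrow_diag (V E W : finType) (a : V -> V -> K) (r : V -> E -> K)
    (nu : W -> K) (g h : W -> W -> K) :
  (forall u w, \sum_v h u v * g v w = (u == w)%:R) ->
  \det (block_mx (finmx a)
          (finmx (fun v (y : E * W) => r v y.1 * nu y.2))
          (finmx (fun (x : E * W) v => r v x.1 * nu x.2))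
          (finmx (fun x y : E * W => g x.2 y.2 *+ (x.1 == y.1)))) =
  \det (finmx g) ^+ #|E| *
  \det (finmx a - (\sum_u \sum_w nu u * h u w * nu w) *:
                  finmx (fun v w => \sum_e r v e * r w e)).
Proof.
move=> hg.
rewrite (@det_Schur _ _ _ _ _ _
  (finmx (fun x y : E * W => h x.2 y.2 *+ (x.1 == y.1)))).
  rewrite det_finmx_diag !mul_finmx; congr (_ * \det (_ - _)).
  apply/matrixP=> i j; rewrite !mxE; move: (enum_val i) (enum_val j) => v w.
  under eq_bigr=> y _.
    under eq_bigr=> z _ do rewrite mulrnAr.
    rewrite (sum_pair_diag (fun e u => r v e * nu u * h u y.2)).
  over.
  rewrite -(pair_bigA _ (fun e u =>
    (\sum_t r v e * nu t * h t u) * (r w e * nu u))) /=.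
  rewrite mulr_sumr; apply: eq_bigr=> e _.
  rewrite exchange_big /= mulr_suml; apply: eq_bigr=> u _.
  by rewrite !mulr_suml; apply: eq_bigr=> t _; ring.
rewrite mul_finmx scalar_finmx; apply: eq_finmx => -[e u] [e' w] /=.
under eq_bigr=> y _ do rewrite mulrnAr.
rewrite (sum_pair_diag (fun f t => h u t *+ (e == f) * g t w)) xpair_eqE.
have [_|_] /= := eqVneq e e'; first exact: hg.
by rewrite big1 // => t _; rewrite mul0r.
Qed.

Lemma det_finmx_unit (f : unit -> unit -> K) : \det (finmx f) = f tt tt.
Proof.
rewrite -(@det_reindex 1 _ (fun=> tt)) ?det_mx11 ?mxE //.
by exists (fun=> ord0) => [i|[]]; rewrite ?[RHS]ord1.
Qed.

Lemma sum_unit (F : unit -> K) : \sum_x F x = F tt.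
Proof. by rewrite (big_pred1 tt) // => -[]. Qed.

End FinMatrix.

(** * Laplacian entries, incident edges and orientations *)

Section SignedGraphs.
Variable K : fieldType.

Definition lap_entry (G : sigraph) (x y : G) : K :=
  (degree x)%:R *+ (x == y) - (if adj x y then (sgn x y)%:~R else 0).

Lemma lapmxE (G : sigraph) : lapmx K G = finmx (@lap_entry G).
Proof.
by apply/matrixP=> i j; rewrite !mxE /lap_entry (inj_eq enum_val_inj).
Qed.

Lemma scalar_sub_lapmx (G : sigraph) (x : K) :
  x%:M - lapmx K G =
  finmx (fun u v : G => (x - (degree u)%:R) *+ (u == v) +
                        (if adj u v then (sgn u v)%:~R else 0)).
Proof.
rewrite lapmxE scalar_finmx; apply/matrixP=> i j; rewrite !mxE /lap_entry.
by rewrite mulrnBl opprB addrA [LHS]addrAC.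
Qed.

Lemma degreeE (G : sigraph) (u : G) : degree u = (\sum_v adj u v)%N.
Proof. by rewrite /degree -sum1dep_card big_mkcond. Qed.

Lemma edgeP (G : sigraph) (e : edge G) :
  exists u v, adj u v /\ val e = [set u; v].
Proof.
have /imsetP[[u v]] := valP e; rewrite inE /= => uv ->.
by exists u, v.
Qed.

Lemma adj_neq (G : sigraph) (u v : G) : adj u v -> u != v.
Proof. by apply: contraTneq => ->; rewrite adj_irrefl. Qed.

Lemma card_edge_ends (G : sigraph) (e : edge G) : #|val e| = 2%N.
Proof. by have [u [v [/adj_neq uv ->]]] := edgeP e; rewrite cards2 uv. Qed.

Lemma adj_edge (G : sigraph) (u v : G) : adj u v -> [set u; v] \in edge_set G.
Proof. by move=> uv; apply/imsetP; exists (u, v); rewrite ?inE. Qed.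

Definition mk_edge (G : sigraph) (u v : G) (uv : adj u v) : edge G :=
  exist (fun e : {set G} => e \in edge_set G) _ (adj_edge uv).

Lemma edge_pair (G : sigraph) (e : edge G) (u v : G) :
  u \in val e -> v \in val e -> u != v -> adj u v /\ val e = [set u; v].
Proof.
have [a [b [ab ->]]] := edgeP e.
rewrite !inE => /orP[]/eqP-> /orP[]/eqP->; rewrite ?eqxx // => _.
by rewrite adj_sym setUC.
Qed.

(** The map sending [v] to [[set u; v]] is a bijection from the neighbours of [u] to the edges
    containing [u]. *)
Lemma card_incident (G : sigraph) (u : G) :
  (\sum_(e : edge G) (u \in val e))%N = degree u.
Proof.
rewrite /degree -(card_in_imset (f := fun v => [set u; v])); last first.
  move=> v w; rewrite !inE => /adj_neq uv _ /setP/(_ v).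
  by rewrite !inE eqxx orbT eq_sym (negPf uv) => /esym/eqP.
have -> : (\sum_(e : edge G) (u \in val e))%N =
    #|[set e : edge G | u \in val e]|.
  by rewrite -sum1dep_card [RHS]big_mkcond.
rewrite -[LHS](card_imset _ val_inj); apply: eq_card => A.
apply/imsetP/imsetP => [[e]|[v]]; rewrite !inE.
  move=> ue ->; have [a [b [ab eE]]] := edgeP e.
  move: ue; rewrite eE !inE => /orP[]/eqP->.
    by exists b; rewrite ?inE.
  by exists a; rewrite ?inE 1?adj_sym 1?setUC.
by move=> uv ->; exists (mk_edge uv); rewrite ?inE ?eqxx.
Qed.

(** This is [theta theta^T = D + A]. On the diagonal each incident edge contributes the square of a
    sign; off the diagonal only the edge joining [u] and [v] contributes, and the orientation axiom
    makes its term [sgn u v]. *)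
Lemma sum_theta (G : sigraph) (th : r_orientation G) (u v : G) :
  \sum_e (th u e)%:~R * (th v e)%:~R =
  (degree u)%:R *+ (u == v) + (if adj u v then (sgn u v)%:~R else 0) :> K.
Proof.
have [<-|uv] := eqVneq u v.
  rewrite adj_irrefl addr0 -card_incident natr_sum; apply: eq_bigr=> e _.
  have [ue|ue] := boolP (u \in val e); last by rewrite theta_out ?mul0r.
  by case/orP: (theta_end th ue) => /eqP->; rewrite -intrM.
rewrite add0r; case: ifP => auv; last first.
  rewrite big1 // => e _.
  have [ue|ue] := boolP (u \in val e); last by rewrite theta_out ?mul0r.
  have [ve|ve] := boolP (v \in val e); last by rewrite [th v e]theta_out ?mulr0.
  by have [] := edge_pair ue ve uv; rewrite auv.
pose e0 := mk_edge auv.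
rewrite (bigD1 e0) //= big1 ?addr0.
  by rewrite -intrM (@theta_sgn _ _ u v).
move=> e ne.
have [ue|ue] := boolP (u \in val e); last by rewrite theta_out ?mul0r.
have [ve|ve] := boolP (v \in val e); last by rewrite [th v e]theta_out ?mulr0.
have [_ eE] := edge_pair ue ve uv.
by case/eqP: ne; apply: val_inj; rewrite eE.
Qed.


(** * The determinant of [x - L] for the corona *)

Section Corona.
Variables (G : sigraph) (th : r_orientation G) (H : signed_graph).
Local Notation Cor := (corona th H).

Lemma sum_corona (F : Cor -> nat) :
  (\sum_x F x = \sum_v F (inl (inl v)) + \sum_e F (inl (inr e)) +
                \sum_e \sum_u F (inr (e, u)))%N.
Proof.
by rewrite !big_sumType /= pair_bigA; congr (_ + _)%N; apply: eq_bigr => -[].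
Qed.

(** Each edge at [v] supplies one subdivision vertex and the [#|H|] vertices of its copy of [H]. *)
Lemma degree_corona_base (v : G) :
  degree (inl (inl v) : Cor) = (degree v * (#|H| + 1))%N.
Proof.
rewrite degreeE sum_corona /= big1 // add0n card_incident mulnDr muln1 addnC.
congr (_ + _)%N; rewrite -card_incident big_distrl; apply: eq_bigr=> e _.
by rewrite sum_nat_const mulnC.
Qed.

Lemma degree_corona_mid (e : edge G) : degree (inl (inr e) : Cor) = 2%N.
Proof.
rewrite degreeE sum_corona /= [X in (_ + X + _)%N]big1 //.
rewrite [X in (_ + X)%N]big1; last by move=> f _; rewrite big1.
by rewrite !addn0 -(card_edge_ends e) -sum1_card [RHS]big_mkcond.
Qed.

Lemma degree_corona_copy (e : edge G) (u : H) :
  degree (inr (e, u) : Cor) = (degree u + 2)%N.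
Proof.
rewrite degreeE sum_corona /= [X in (_ + X + _)%N]big1 // addn0 addnC.
rewrite -(card_edge_ends e) -sum1_card [X in _ = (_ + X)%N]big_mkcond.
congr (_ + _)%N; rewrite (bigD1 e) //= [X in (_ + X)%N]big1 ?addn0.
  by rewrite degreeE; apply: eq_bigr=> w _; rewrite eqxx.
by move=> f /negPf fe; rewrite big1 // => w _; rewrite eq_sym fe.
Qed.

(* The subdivision vertex plays the role of an additional isolated vertex of  *)
(* H marked +1.                                                               *)
Definition corona_regroup (x : G + edge G * (unit + H)) : Cor :=
  match x with
  | inl v => inl (inl v)
  | inr (e, inl _) => inl (inr e)
  | inr (e, inr u) => inr (e, u)
  end.

Lemma corona_regroup_bij : bijective corona_regroup.
Proof.
pose k (x : Cor) : G + edge G * (unit + H) :=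
  match x with
  | inl (inl v) => inl v
  | inl (inr e) => inr (e, inl tt)
  | inr (e, u) => inr (e, inr u)
  end.
by exists k => [[v|[e [[]|u]]]|[[v|e]|[e u]]].
Qed.

Definition block_mark (o : unit + H) : K :=
  if o is inr u then (mark u)%:~R else 1.

(** The direct sum of the scalar [c] and [f]; it describes both the repeated diagonal block and its
    inverse. *)
Definition block_sum (T : finType) (c : K) (f : T -> T -> K)
    (o o' : unit + T) : K :=
  match o, o' with
  | inl _, inl _ => c
  | inr u, inr w => f u w
  | _, _ => 0
  end.

Lemma det_block_sum (T : finType) (c : K) (f : T -> T -> K) :
  \det (finmx (block_sum c f)) = c * \det (finmx f).
Proof.
rewrite det_finmx_sum.
have -> : finmx (fun x y => block_sum c f (inl x) (inr y)) = 0.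
  by apply/matrixP=> i j; rewrite !mxE.
by rewrite det_lblock det_finmx_unit.
Qed.

Lemma det_corona (g : nat) (x : K) :
  regular G g -> x - 2 != 0 -> (x - 2)%:M - lapmx K H \in unitmx ->
  \det (x%:M - lapmx K Cor) =
    (x - 2) ^+ #|edge G| * \det ((x - 2)%:M - lapmx K H) ^+ #|edge G| *
    \det ((x - g%:R * (#|H|%:R + 1))%:M -
          ((x - 2)^-1 + lap_coronal H (x - 2)) *: ((2 * g%:R)%:M - lapmx K G)).
Proof.
move=> reg x2 Nunit.
pose N (u w : H) : K := (x - 2) *+ (u == w) - lap_entry u w.
pose N' (u w : H) : K :=
  invmx ((x - 2)%:M - lapmx K H) (enum_rank u) (enum_rank w).
have NE : (x - 2)%:M - lapmx K H = finmx N.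
  by rewrite lapmxE scalar_finmx; apply/matrixP=> i j; rewrite !mxE.
have N'E : invmx ((x - 2)%:M - lapmx K H) = finmx N'.
  by apply/matrixP=> i j; rewrite !mxE /N' !enum_valK.
have NN' u w : \sum_v N' u v * N v w = (u == w)%:R.
  have := mulVmx Nunit; rewrite N'E NE mul_finmx scalar_finmx.
  by move/matrixP/(_ (enum_rank u) (enum_rank w)); rewrite !mxE !enum_rankK.
have inv u w : \sum_v block_sum (x - 2)^-1 N' u v * block_sum (x - 2) N v w
    = (u == w)%:R.
  rewrite big_sumType /= sum_unit; case: u w => [[]|u] [[]|w] /=.
  - by rewrite mulVf // big1 ?addr0 // => v _; rewrite mul0r.
  - by rewrite mulr0 add0r big1 // => v _; rewrite mul0r.
  - by rewrite mul0r add0r big1 // => v _; rewrite mulr0.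
  - by rewrite mul0r add0r NN'.
rewrite scalar_sub_lapmx (det_finmx_bij _ corona_regroup_bij) det_finmx_sum.
pose r (v : G) e : K := (th v e)%:~R.
have := @det_arrow_diag K G (edge G) (unit + H)%type
  (fun v w => (x - g%:R * (#|H|%:R + 1)) *+ (v == w))
  r block_mark _ _ inv.
rewrite det_block_sum -NE exprMn.
(* The quadratic form of the inverse block at the vector [(1, mu)] splits along the direct sum: the
   subdivision vertex gives [(x - 2)^-1] and the copy of [H] gives the coronal. *)
have -> : \sum_u \sum_w
    block_mark u * block_sum (x - 2)^-1 N' u w * block_mark w
   = (x - 2)^-1 + lap_coronal H (x - 2).
  rewrite big_sumType /= sum_unit big_sumType /= sum_unit mul1r mulr1.
  rewrite big1 ?addr0 => [|w _]; last by rewrite mulr0 mul0r.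
  congr (_ + _); rewrite /lap_coronal /coronal N'E !mxE.
  under eq_bigr=> u _.
    rewrite big_sumType /= sum_unit mulr0 mul0r add0r.
  over.
  rewrite exchange_big /= -[LHS]sum_enum_val; apply: eq_bigr=> j _.
  rewrite !mxE -[in LHS]sum_enum_val mulr_suml.
  by apply: eq_bigr=> i _; rewrite !mxE.
have -> : finmx (fun v w => \sum_e r v e * r w e) = (2 * g%:R)%:M - lapmx K G.
  rewrite scalar_sub_lapmx; apply: eq_finmx => u v; rewrite sum_theta reg.
  by congr (_ *+ _ + _); ring.
rewrite (scalar_finmx G (x - g%:R * _)) => <-.
congr (\det (block_mx _ _ _ _)); apply: eq_finmx.
- move=> v w /=; rewrite addr0 degree_corona_base reg natrM natrD.
  by congr (_ *+ _).
- move=> v [e [[]|u]] /=; rewrite add0r /r ?mulr1.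
    by case: ifP => // /negbT/(theta_out th)->.
  rewrite intrM; case: ifP => // /negbT/(theta_out th)->.
  by rewrite mul0r.
- move=> [e [[]|u]] v /=; rewrite add0r /r ?mulr1.
    by case: ifP => // /negbT/(theta_out th)->.
  rewrite intrM; case: ifP => // /negbT/(theta_out th)->.
  by rewrite mul0r.
- move=> [e [[]|u]] [f [[]|w]] /=.
  + by rewrite degree_corona_mid addr0.
  + by rewrite addr0 mul0rn.
  + by rewrite addr0 mul0rn.
  (* A vertex of a copy gains the two endpoints of [e] as neighbours, which turns [x] into
     [x - 2]. *)
  + rewrite degree_corona_copy /N /lap_entry natrD.
    rewrite -[inr _ == _ :> Cor]/((e, u) == (f, w)) xpair_eqE.
    case: (e == f) => /=; last by rewrite addr0.
    by case: (u == w) => /=; rewrite ?mulr0n ?mulr1n; ring.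
Qed.

End Corona.
End SignedGraphs.

(** * From the determinant to a product over eigenvalues *)

Section CharPoly.
Variable K : fieldType.

Lemma horner_char_poly (n : nat) (M : 'M[K]_n) (t : K) :
  (char_poly M).[t] = \det (t%:M - M).
Proof.
rewrite -[LHS]/(horner_eval t _) /char_poly -det_map_mx; congr (\det _).
apply/matrixP=> i j; rewrite !mxE /= /horner_eval.
by rewrite hornerD hornerN hornerC hornerMn hornerX.
Qed.

(** For nonzero [b] the matrix is [- b] times [(c - a / b) - M], so its determinant is a value of
    the characteristic polynomial of [M]. For [b = 0] it is scalar. *)
Lemma det_affine_eigenvalues (n : nat) (M : 'M[K]_n) (lam : 'I_n -> K)
    (a b c : K) :
  eigenvalues_of M lam ->
  \det (a%:M - b *: (c%:M - M)) = \prod_(j < n) (a - b * (c - lam j)).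
Proof.
move=> eM; have [->|b0] := eqVneq b 0.
  rewrite scale0r subr0 det_scalar.
  under eq_bigr=> j _ do rewrite mul0r subr0.
  by rewrite prodr_const card_ord.
have -> : a%:M - b *: (c%:M - M) = - b *: ((c - a / b)%:M - M).
  apply/matrixP=> i j; rewrite !mxE; case: (i == j); rewrite ?mulr1n ?mulr0n.
    by field.
  by ring.
rewrite detZ -horner_char_poly eM horner_prod.
rewrite -[n in _ ^+ n]card_ord -prodr_const.
rewrite -big_split /=; apply: eq_bigr=> j _; rewrite hornerXsubC.
by field.
Qed.

Lemma horner_char_poly_corona (G : sigraph) (th : r_orientation G)
    (H : signed_graph) (g : nat) (lam : 'I_#|G| -> K) (x : K) :
  regular G g -> eigenvalues_of (lapmx K G) lam ->
  x - 2 != 0 -> (char_poly (lapmx K H)).[x - 2] != 0 ->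
  (char_poly (lapmx K (corona th H))).[x] =
    (x - 2) ^ (#|edge G|%:Z - #|G|%:Z) *
    (char_poly (lapmx K H)).[x - 2] ^+ #|edge G| *
    \prod_(j < #|G|)
      (x ^+ 2 - (g%:R + 2 + g%:R * #|H|%:R) * x + 2 * g%:R * (#|H|%:R + 1)
       - (1 + (x - 2) * lap_coronal H (x - 2)) * (2 * g%:R - lam j)).
Proof.
rewrite !horner_char_poly => reg eG x2 Hx.
rewrite (det_corona _ reg) ?unitmxE ?unitfE // (det_affine_eigenvalues _ _ _ eG).
rewrite expfzDr // -exprnP -exprnN.
rewrite -!mulrA; congr (_ * _); rewrite [RHS]mulrCA; congr (_ * _).
(* The negative power of [x - 2] cancels against one factor [x - 2] per eigenvalue, the one that
   clears [(x - 2)^-1] and makes each factor quadratic in [x]. *)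
rewrite -exprVn -[#|G| in X in _ = X * _]card_ord -prodr_const -big_split /=.
by apply: eq_bigr=> j _; field.
Qed.

Lemma map_lapmx (K' : fieldType) (f : {rmorphism K -> K'}) (G : sigraph) :
  map_mx f (lapmx K G) = lapmx K' G.
Proof.
apply/matrixP=> i j; rewrite !mxE rmorphB rmorphMn /= rmorph_nat; congr (_ - _).
by case: ifP => _; rewrite ?rmorph_int ?rmorph0.
Qed.

End CharPoly.

(** * Values of rational functions at a point *)

Section RationalValues.
Variable F : fieldType.
Local Notation T := (@tofrac {poly F}).

Lemma frac_numden (f : {fraction {poly F}}) : f * T \d_(repr f) = T \n_(repr f).
Proof.
rewrite -[X in X * _]reprK; unlock tofrac; rewrite -[LHS]FracField.pi_mul.
apply/eqmodP; rewrite /= FracField.equivfE /FracField.mulf.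
by rewrite !numden_Ratio ?mulf_neq0 ?oner_eq0 ?denom_ratioP //; apply/eqP; ring.
Qed.

Lemma rat_numden (f : {fraction {poly F}}) : f * T (rat_den f) = T (rat_num f).
Proof.
set d := gcdp \n_(repr f) \d_(repr f).
have d0 : T d != 0 by rewrite tofrac_eq0 gcdp_eq0 negb_and denom_ratioP orbT.
apply: (mulIf d0); rewrite -mulrA -!rmorphM /= !divpK ?dvdp_gcdl ?dvdp_gcdr //.
exact: frac_numden.
Qed.

(** Any fraction [p / q] representing [f] with [q.[a] != 0] may serve as witness. Dropping lowest
    terms makes the relation easy to propagate through field operations. *)
Definition rat_value (a : F) (f : {fraction {poly F}}) (c : F) : Prop :=
  exists p q, [/\ q.[a] != 0, f * T q = T p & p.[a] = c * q.[a]].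

Variable a : F.

Lemma rat_value_eval f : ~~ rat_pole f a -> rat_value a f (rat_eval f a).
Proof.
move=> fa; exists (rat_num f), (rat_den f); split=> //; first exact: rat_numden.
by rewrite divfK.
Qed.

Lemma rat_value_tofrac p : rat_value a (T p) p.[a].
Proof. by exists p, 1; rewrite hornerC oner_eq0 rmorph1 !mulr1. Qed.

Lemma rat_valueD f g c d :
  rat_value a f c -> rat_value a g d -> rat_value a (f + g) (c + d).
Proof.
move=> [p [q [q0 fq pE]]] [r [s [s0 gs rE]]]; exists (p * s + r * q), (q * s).
rewrite !hornerE mulf_neq0 // pE rE rmorphD !rmorphM /= -fq -gs.
by split=> //; ring.
Qed.

Lemma rat_valueM f g c d :
  rat_value a f c -> rat_value a g d -> rat_value a (f * g) (c * d).
Proof.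
move=> [p [q [q0 fq pE]]] [r [s [s0 gs rE]]]; exists (p * r), (q * s).
rewrite !hornerE mulf_neq0 // pE rE !rmorphM /= -fq -gs.
by split=> //; ring.
Qed.

Lemma rat_valueN f c : rat_value a f c -> rat_value a (- f) (- c).
Proof.
move=> [p [q [q0 fq pE]]]; exists (- p), q.
by rewrite hornerN pE rmorphN /= -fq !mulNr.
Qed.

Lemma rat_valueV f c : c != 0 -> rat_value a f c -> rat_value a f^-1 c^-1.
Proof.
move=> c0 [p [q [q0 fq pE]]]; exists q, p; split.
- by rewrite pE mulf_neq0.
- rewrite -fq mulrA mulVf ?mul1r //; apply: contra_eq_neq fq => ->.
  rewrite mul0r eq_sym tofrac_eq0; apply: contraNneq (mulf_neq0 c0 q0) => p0.
  by rewrite -pE p0 horner0.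
- by rewrite pE mulKf.
Qed.

Lemma rat_value_nat n : rat_value a n%:R n%:R.
Proof.
have := rat_value_tofrac n%:R; rewrite rmorph_nat.
by rewrite -[X in X.[a]]polyC_natr hornerC.
Qed.

Lemma rat_valueX f c n : rat_value a f c -> rat_value a (f ^+ n) (c ^+ n).
Proof.
move=> fc; elim: n => [|n IHn]; first exact: (rat_value_nat 1).
by rewrite !exprS; apply: rat_valueM.
Qed.

Lemma rat_value_prod (n : nat) (f : 'I_n -> {fraction {poly F}})
    (c : 'I_n -> F) :
  (forall j, rat_value a (f j) (c j)) ->
  rat_value a (\prod_j f j) (\prod_j c j).
Proof.
move=> fc; apply: (big_rec2 (rat_value a)) => [|j y1 y2 _ ?].
  exact: (rat_value_nat 1).
exact: rat_valueM.
Qed.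

(** A negative power of a function vanishing at [a] may have a pole there, while [0 ^-1 = 0] in the
    field. The hypothesis excludes negative exponents when [c = 0]. *)
Lemma rat_valueXz f c (m n : nat) : (c = 0 -> (n <= m)%N) ->
  rat_value a f c -> rat_value a (f ^ (m%:Z - n%:Z)) (c ^ (m%:Z - n%:Z)).
Proof.
move=> cmn fc; have [nm|mn] := leqP n m.
  by rewrite subzn // -!exprnP; apply: rat_valueX.
have c0 : c != 0 by apply/eqP => /cmn; rewrite leqNgt mn.
rewrite -[_ - _]opprB subzn ?(ltnW mn) // -!exprnN.
by apply: rat_valueV; rewrite ?expf_neq0 //; apply: rat_valueX.
Qed.

(** [tofrac] is injective, so [p * q = r] holds for polynomials; evaluate at [a] and cancel
    [q.[a]]. *)
Lemma rat_value_uniq p c : rat_value a (T p) c -> p.[a] = c.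
Proof.
move=> [r [q [q0]]]; rewrite -rmorphM => /eqP; rewrite tofrac_eq => /eqP <-.
by rewrite hornerM => /(mulIf q0).
Qed.

End RationalValues.

(** * Extension of scalars to the rational functions *)

Section FractionEmbedding.
Variable F : fieldType.
Local Notation Fr := {fraction {poly F}}.
Local Notation T := (@tofrac {poly F}).

Let emb : {rmorphism F -> Fr} := (T \o polyC)%FUN.

(** The Laplacian has integer entries, so its characteristic polynomial over [Fr] is the image of
    the one over [F]. *)
Lemma char_poly_lapmx_frac (G : sigraph) (q : {poly F}) :
  (char_poly (lapmx Fr G)).[T q] = T (char_poly (lapmx F G) \Po q).
Proof.
rewrite -(map_lapmx emb) -map_char_poly map_poly_comp.
exact: horner_map.
Qed.

Lemma eigenvalues_lapmx_frac (G : sigraph) (lam : 'I_#|G| -> F) :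
  eigenvalues_of (lapmx F G) lam ->
  eigenvalues_of (lapmx Fr G) (fun j => ratC (lam j)).
Proof.
rewrite /eigenvalues_of -(map_lapmx emb) -map_char_poly => ->.
rewrite rmorph_prod; apply: eq_bigr=> j _.
by rewrite rmorphB /= map_polyX map_polyC.
Qed.

End FractionEmbedding.

(** * The identity of rational functions and its pointwise values *)

Theorem theorem5p17 (C : numClosedFieldType) (G1 G2 : signed_graph)
    (g1 n1 m1 n2 : nat) (th : r_orientation G1) (lam : 'I_#|G1| -> C)
    (hn1 : #|G1| = n1) (hm1 : #|edge G1| = m1) (hn2 : #|G2| = n2)
    (hreg : regular G1 g1)
    (hlam : eigenvalues_of (lapmx C G1) lam) :
  (forall l : C,
     ~~ rat_pole (lap_coronal G2 (ratX C - 2)) l ->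
     (l = 2 -> (n1 <= m1)%N) ->
     (char_poly (lapmx C (corona th G2))).[l] =
       (l - 2) ^ (m1%:Z - n1%:Z) *
       (char_poly (lapmx C G2)).[l - 2] ^+ m1 *
       \prod_(j < #|G1|)
         (l ^+ 2 - (g1%:R + 2 + g1%:R * n2%:R) * l + 2 * g1%:R * (n2%:R + 1)
          - (1 + (l - 2) * rat_eval (lap_coronal G2 (ratX C - 2)) l)
            * (2 * g1%:R - lam j)))
  /\
  (let X := ratX C in
   tofrac (char_poly (lapmx C (corona th G2))) =
     (X - 2) ^ (m1%:Z - n1%:Z) *
     (char_poly (lapmx {fraction {poly C}} G2)).[X - 2] ^+ m1 *
     \prod_(j < #|G1|)
       (X ^+ 2 - (g1%:R + 2 + g1%:R * n2%:R) * X + 2 * g1%:R * (n2%:R + 1)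
        - (1 + (X - 2) * lap_coronal G2 (X - 2))
          * (2 * g1%:R - ratC (lam j)))).
Proof.
have X2 : ratX C - 2 = tofrac ('X - 2%:P).
  by rewrite rmorphB /= polyC_natr rmorph_nat.
have charX2 : (char_poly (lapmx {fraction {poly C}} G2)).[ratX C - 2] =
    tofrac (char_poly (lapmx C G2) \Po ('X - 2%:P)).
  by rewrite X2 char_poly_lapmx_frac.
rewrite and_comm; set rat_identity := let X := _ in _.
have H : rat_identity.
  have charX := char_poly_lapmx_frac (corona th G2) ('X : {poly C}).
  rewrite comp_polyXr in charX.
  rewrite /rat_identity -charX -hn1 -hm1 -hn2.
  apply: horner_char_poly_corona => //.
  - exact: eigenvalues_lapmx_frac.
  (* Over the rational functions [X - 2] is a nonzero polynomial, so no value of [l] needs excluding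
     here. *)
  - by rewrite X2 tofrac_eq0 polyXsubC_eq0.
  - rewrite charX2 tofrac_eq0 comp_poly2_eq0 ?size_XsubC //.
    exact: monic_neq0 (char_poly_monic _).
(* Both sides of the identity are evaluated at [l]. Only the coronal must have a value there;
   [l - 2] may be zero or an eigenvalue of the Laplacian of [G2]. *)
split=> // l nopole l2; apply: rat_value_uniq; rewrite H.
have vX : rat_value l (ratX C) l.
  by have := rat_value_tofrac l 'X; rewrite hornerX.
have vX2 : rat_value l (ratX C - 2) (l - 2).
  exact: rat_valueD vX (rat_valueN (rat_value_nat l 2)).
have vS := rat_value_eval nopole.
have vC (c : C) : rat_value l (ratC c) c.
  by have := rat_value_tofrac l c%:P; rewrite hornerC.
apply: rat_valueM; first apply: rat_valueM.
- by apply: rat_valueXz vX2 => /subr0_eq/l2.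
- apply: rat_valueX; rewrite charX2.
  have := rat_value_tofrac l (char_poly (lapmx C G2) \Po ('X - 2%:P)).
  by rewrite horner_comp hornerXsubC.
apply: rat_value_prod => j.
by do ?[ exact: vX2 | exact: vX | exact: vS | exact: vC | exact: rat_value_nat
       | exact: (rat_value_nat l 1)
       | apply: rat_valueD | apply: rat_valueN | apply: rat_valueX
       | apply: rat_valueM].
Qed.
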